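(* Consider the two-dimensional Poisson regression model with interaction and $\boldsymbol{\beta}=(\beta_0,\beta_1,\beta_2,\beta_{12})^\top$ with $\beta_0\in\mathbb{R}$, $\beta_1,\beta_2<0$ and $\beta_{12}\le 0$. Let $\rho=-\beta_{12}/(\beta_1\beta_2)$, and let $t=(\sqrt{1+8\rho}-1)/(2\rho)$ if $\beta_{12}<0$ and $t=2$ if $\beta_{12}=0$. Then the design which assigns equal weights $1/4$ to the four settings $\mathbf{x}_0=(0,0)$, $\mathbf{x}_1=(2/|\beta_1|,0)$, $\mathbf{x}_2=(0,2/|\beta_2|)$ and $\mathbf{x}_3=(t/|\beta_1|,t/|\beta_2|)$ is locally $D$-optimal at $\boldsymbol{\beta}$ on $\mathcal{X}=[0,\infty)^2$.
   Context: In the two-dimensional Poisson regression model with interaction, an observation $Y$ at setting $\mathbf{x}=(x_1,x_2)$ is Poisson distributed with mean $\lambda(\mathbf{x})=\exp(\mathbf{f}(\mathbf{x})^\top\boldsymbol{\beta})$, where $\mathbf{f}(\mathbf{x})=(1,x_1,x_2,x_1x_2)^\top$. An (approximate) design $\xi$ on $\mathcal{X}$ is a finite collection of mutually distinct settings $\mathbf{x}_0,\dots,\mathbf{x}_{n-1}\in\mathcal{X}$ with weights $w_i\ge 0$, $\sum_i w_i=1$; its information matrix is $\mathbf{M}_{\boldsymbol{\beta}}(\xi)=\sum_i w_i\lambda(\mathbf{x}_i)\mathbf{f}(\mathbf{x}_i)\mathbf{f}(\mathbf{x}_i)^\top$. A design is locally $D$-optimal at $\boldsymbol{\beta}$ on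 $\mathcal{X}$ if it maximizes $\det\mathbf{M}_{\boldsymbol{\beta}}(\xi)$ over all designs on $\mathcal{X}$. *)

(* Defs.v *)
From HB Require Import structures.
From mathcomp Require Import all_boot all_order all_algebra.
From mathcomp Require Import all_classical all_reals all_analysis.
Set Implicit Arguments. Unset Strict Implicit. Unset Printing Implicit Defensive.
Import Order.TTheory GRing.Theory Num.Theory.
Local Open Scope ring_scope.

Section Defs.
Variable R : realType.

Definition fvec (x : R * R) : 'cV[R]_4 :=
  \col_(i < 4) nth 0 [:: 1; x.1; x.2; x.1 * x.2] i.

Definition betavec (b0 b1 b2 b12 : R) : 'cV[R]_4 :=
  \col_(i < 4) nth 0 [:: b0; b1; b2; b12] i.

Definition intensity (beta : 'cV[R]_4) (x : R * R) : R :=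
  expR (((fvec x)^T *m beta) 0 0).

Definition is_design_on (X : set (R * R)) (n : nat)
    (x : 'I_n -> R * R) (w : 'I_n -> R) : Prop :=
  injective x /\ (forall i, X (x i)) /\ (forall i, 0 <= w i) /\ \sum_(i < n) w i = 1.

Definition info_matrix (beta : 'cV[R]_4) (n : nat)
    (x : 'I_n -> R * R) (w : 'I_n -> R) : 'M[R]_4 :=
  \sum_(i < n) (w i * intensity beta (x i)) *: (fvec (x i) *m (fvec (x i))^T).

Definition locally_D_optimal (beta : 'cV[R]_4) (X : set (R * R)) (n : nat)
    (x : 'I_n -> R * R) (w : 'I_n -> R) : Prop :=
  is_design_on X x w /\
  forall (m : nat) (y : 'I_m -> R * R) (v : 'I_m -> R),
    is_design_on X y v ->
    \det (info_matrix beta y v) <= \det (info_matrix beta x w).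

Definition quadrant : set (R * R) := fun p => 0 <= p.1 /\ 0 <= p.2.

End Defs.

(* Main.v *)
(* By Hadamard's inequality and AM-GM a positive semidefinite 4 x 4 matrix of
   trace at most 1 has determinant at most (1/4)^4.  Expressing the regression
   functions in the basis dual to the four support points, scaled by
   lambda(x_i)^(-1/2), turns the information matrix of the candidate into 1/4
   times the identity, and that of any other design into a matrix of trace at
   most 1, provided that
     lambda(x) * sum_i g_i(x)^2 / lambda(x_i) <= 1   on the quadrant,
   with g_i the Lagrange basis.  In the coordinates x_i = t u_i / |b_i| the
   left-hand sum is convex along the level lines of lambda (as functions of
   u1 + u2 and u1 u2), which reduces the inequality to the axis u1 u2 = 0 and
   the diagonal u1 = u2. *)
Require Import Defs.
From HB Require Import structures.
From mathcomp Require Import all_boot all_order all_algebra.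
From mathcomp Require Import all_classical all_reals all_analysis.
From mathcomp Require Import ring lra.
Set Implicit Arguments. Unset Strict Implicit. Unset Printing Implicit Defensive.
Import Order.TTheory GRing.Theory Num.Theory.
Import numFieldNormedType.Exports.
Local Open Scope ring_scope.

(** * Calculus: the bound on the sensitivity function *)

Section Analysis.
Context {R : realType}.
Implicit Types (f psi w : R -> R) (a b x t u v : R).

Lemma ler_of_is_derive_ge0 f f' a b :
  (forall x : R, is_derive x 1 f (f' x)) ->
  (forall x, a <= x <= b -> 0 <= f' x) -> a <= b -> f a <= f b.
Proof.
move=> df f'0 ab; rewrite -subr_ge0.
have cf : {within `[a, b], continuous f}%classic.
  apply: derivable_within_continuous => x _.
  exact: (@ex_derive _ _ _ _ _ _ _ (df x)).
have [c] := MVT_segment ab (fun x _ => df x) cf.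
by rewrite in_itv/= => /f'0 c0 ->; rewrite mulr_ge0// subr_ge0.
Qed.

Lemma ger_of_is_derive_le0 f f' a b :
  (forall x : R, is_derive x 1 f (f' x)) ->
  (forall x, a <= x <= b -> f' x <= 0) -> a <= b -> f b <= f a.
Proof.
move=> df f'0 ab; rewrite -lerN2.
apply: (@ler_of_is_derive_ge0 (fun x => - f x) (fun x => - f' x)) => // x.
by rewrite oppr_ge0; exact: f'0.
Qed.

(** Up to a nonnegative factor the derivative is the nondecreasing [psi], so [f] falls and then
    rises, and is largest at an end. *)
Lemma valley_le f w psi a b (M : R) x :
  (forall y : R, is_derive y 1 f (w y * psi y)) ->
  (forall y, a <= y <= b -> 0 <= w y) ->
  (forall y z, a <= y -> y <= z -> z <= b -> psi y <= psi z) ->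
  f a <= M -> f b <= M -> a <= x <= b -> f x <= M.
Proof.
move=> df w0 psi_ndecr faM fbM /andP[ax xb].
have [psi0|/ltW psi0] := leP (psi x) 0.
- apply: le_trans faM.
  apply: (@ger_of_is_derive_le0 _ _ _ _ df) => // y /andP[ay yx].
  rewrite mulr_ge0_le0 ?w0 ?ay ?(le_trans yx)//.
  exact: le_trans (psi_ndecr _ _ ay yx xb) psi0.
- apply: le_trans fbM.
  apply: (@ler_of_is_derive_ge0 _ _ _ _ df) => // y /andP[xy yb].
  rewrite mulr_ge0 ?w0 ?yb ?(le_trans ax)//.
  exact: le_trans psi0 (psi_ndecr _ _ ax xy yb).
Qed.

Lemma is_derive_quad_exp (c0 c1 c2 k x : R) :
  is_derive x 1 (fun x => c0 + c1 * x + c2 * x ^+ 2 + k * expR x)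
    (c1 + 2 * c2 * x + k * expR x).
Proof.
by apply: is_derive_eq; rewrite /GRing.scale/=; ring.
Qed.

Lemma is_derive_expRM f (df a x : R) : is_derive x 1 f df ->
  is_derive x 1 (fun x => expR (- (a * x)) * f x)
    (expR (- (a * x)) * (df - a * f x)).
Proof.
move=> dfx.
have de : is_derive x 1 (fun y => expR (- (a * y))) (expR (- (a * x)) * - a).
  apply: is_derive1_comp; apply: is_derive_eq; rewrite /GRing.scale/=; ring.
by apply: is_derive_eq; rewrite /GRing.scale/=; ring.
Qed.

Lemma expR2_ge3 : 3 <= expR 2 :> R.
Proof. by have := @expR_ge1Dx R 2; lra. Qed.

(** Divided by the right-hand side, the left has a valley on [0, 1] with value 1 at both ends, which
    correspond to support points, and decreases beyond 1. *)
Lemma axis_bound v : 0 <= v ->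
  (1 - v) ^+ 2 + expR 2 * v ^+ 2 <= expR (2 * v).
Proof.
move=> v0; have e3 := expR2_ge3; set e := expR 2 in e3 *.
pose q x : R := 1 + - 2 * x + (1 + e) * x ^+ 2 + 0 * expR x.
pose g x := expR (- (2 * x)) * q x.
pose w x : R := 2 * (expR (- (2 * x)) * (1 - x)).
pose psi x := - 2 + (1 + e) * x.
have dg x : is_derive x 1 g (w x * psi x).
  have dq := is_derive_quad_exp 1 (-2) (1 + e) 0 x.
  have := is_derive_expRM 2 dq; rewrite -/q -/g => dg.
  by apply: (is_derive_eq dg); rewrite /q /w /psi; ring.
have g1 : g 1 = 1.
  by rewrite /g /q mulr1 -[RHS](mulVf (lt0r_neq0 (expR_gt0 (2:R)))) expRN /e; ring.
have g_le1 : g v <= 1.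
  have [v1|/ltW v1] := leP v 1.
    apply: (@valley_le g w psi 0 1) => //.
    - by move=> y /andP[_ y1]; rewrite /w !mulr_ge0 ?expR_ge0// subr_ge0.
    - by move=> y z _ yz _; rewrite /psi; nra.
    - by rewrite /g /q !mulr0 oppr0 expR0; lra.
    - by rewrite g1.
    - by rewrite v0.
  rewrite -g1; apply: (@ger_of_is_derive_le0 g _ _ _ dg) => // x /andP[x1 _].
  rewrite mulr_le0_ge0// /w /psi; last by nra.
  by rewrite mulr_ge0_le0// mulr_ge0_le0 ?expR_ge0// subr_le0.
have -> : (1 - v) ^+ 2 + e * v ^+ 2 = expR (2 * v) * g v.
  by rewrite /g expRN mulVKf ?gt_eqF ?expR_gt0// /q; ring.
by rewrite ler_piMr ?expR_ge0.
Qed.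

(* Multiplied by [expR (- (t * (2 * u - u ^+ 2)))], the left-hand side first
   decreases and then increases in t, so only t = 0 and t = 2 matter;
   there the claim is [axis_bound] at u ^+ 2 and the square of [axis_bound]
   at u. *)
Lemma diagonal_bound u t : 0 <= u -> 0 <= t <= 2 ->
  (1 - u) ^+ 2 * ((1 + u - t * u) ^+ 2 + expR 2 / 2 * (t * u) ^+ 2)
    + expR (t + 2) * u ^+ 4
  <= expR (2 * t * u + (2 - t) * u ^+ 2).
Proof.
move=> u0 t02; have e3 := expR2_ge3.
rewrite expRD; set e := expR 2 in e3 *; pose a := 2 * u - u ^+ 2.
pose q x : R := ((1 - u) ^+ 2 * (1 + u) ^+ 2)
  + (- (2 * u * (1 + u)) * (1 - u) ^+ 2) * x
  + (u ^+ 2 * (1 + e / 2) * (1 - u) ^+ 2) * x ^+ 2 + (e * u ^+ 4) * expR x.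
pose g x := expR (- (a * x)) * q x.
pose w x : R := expR (- (a * x)) * (1 - u) ^+ 2.
pose psi x : R := (- (2 * u * (1 + u)) - a * (1 + u) ^+ 2)
  + (2 * (u ^+ 2 * (1 + e / 2)) + a * (2 * u * (1 + u))) * x
  + (- (a * (u ^+ 2 * (1 + e / 2)))) * x ^+ 2 + (e * u ^+ 4) * expR x.
have dg x : is_derive x 1 g (w x * psi x).
  have dq := is_derive_quad_exp ((1 - u) ^+ 2 * (1 + u) ^+ 2)
    (- (2 * u * (1 + u)) * (1 - u) ^+ 2)
    (u ^+ 2 * (1 + e / 2) * (1 - u) ^+ 2) (e * u ^+ 4) x.
  have := is_derive_expRM a dq; rewrite -/q -/g => dg.
  by apply: (is_derive_eq dg); rewrite /q /w /psi /a; field.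
have dpsi x := is_derive_quad_exp (- (2 * u * (1 + u)) - a * (1 + u) ^+ 2)
  (2 * (u ^+ 2 * (1 + e / 2)) + a * (2 * u * (1 + u)))
  (- (a * (u ^+ 2 * (1 + e / 2)))) (e * u ^+ 4) x.
have psi_ndecr y z : 0 <= y -> y <= z -> z <= 2 -> psi y <= psi z.
  move=> y0 yz z2; apply: (@ler_of_is_derive_ge0 psi _ y z dpsi) => // x.
  move=> /andP[yx xz]; have x0 : 0 <= x by lra.
  have x2 : x <= 2 by lra.
  have -> : 2 * (u ^+ 2 * (1 + e / 2)) + a * (2 * u * (1 + u)) +
      2 * (- (a * (u ^+ 2 * (1 + e / 2)))) * x + e * u ^+ 4 * expR x =
    2 * u ^+ 2 * ((1 + (2 - u) * (1 + u - x * u))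
      + e / 2 * (1 - 2 * x * u + u ^+ 2 * (x + expR x))).
    by rewrite /a; field.
  rewrite mulr_ge0 ?mulr_ge0 ?sqr_ge0//.
  have ex := @expR_ge1Dx R x.
  have q0 : 0 <= 1 - 2 * x * u + u ^+ 2 * (1 + 2 * x).
    have -> : 1 - 2 * x * u + u ^+ 2 * (1 + 2 * x) =
      (1 - x * u) ^+ 2 + u ^+ 2 * (1 + x * (2 - x)) by ring.
    by rewrite addr_ge0 ?sqr_ge0// mulr_ge0 ?sqr_ge0//; nra.
  have qe : 1 - 2 * x * u + u ^+ 2 * (1 + 2 * x) <=
      1 - 2 * x * u + u ^+ 2 * (x + expR x).
    by rewrite lerD2l ler_wpM2l ?sqr_ge0//; lra.
  have qe' : 1 - 2 * x * u + u ^+ 2 * (1 + 2 * x) <=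
      e / 2 * (1 - 2 * x * u + u ^+ 2 * (x + expR x)).
    apply: (le_trans qe); rewrite ler_peMl//; last by lra.
    exact: le_trans qe.
  (* For [u <= 2] the first bracket is smallest at [x = 2], where it equals
     [(u - 3 / 2) ^+ 2 + 3 / 4]. For larger [u] the sum is at least [4 + u + x * u * (u - 2) + 2 * x
     * u * (u - 1)]. *)
  have [u2|u2] := leP u 2.
    suff : 0 <= 1 + (2 - u) * (1 + u - x * u) by lra.
    have : 0 <= (2 - u) * (u * (2 - x)) by rewrite !mulr_ge0//; lra.
    by have : 0 <= (u - 3 / 2) ^+ 2 := sqr_ge0 _; nra.
  have h1 : 0 <= x * (u * (u - 2)) by rewrite !mulr_ge0//; lra.
  have h2 : 0 <= x * (u * (u - 1)) by rewrite !mulr_ge0//; lra.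
  nra.
have g_le : g t <= expR (2 * u ^+ 2).
  apply: (@valley_le g w psi 0 2) => //.
  - by move=> y _; rewrite /w mulr_ge0 ?expR_ge0 ?sqr_ge0.
  - rewrite /g /q !mulr0 oppr0 expR0.
    have := axis_bound (sqr_ge0 u); rewrite -/e; nra.
  - have -> : g 2 = expR (- (a * 2)) * ((1 - u) ^+ 2 + e * u ^+ 2) ^+ 2.
      by rewrite /g /q -/e; field.
    have -> : 2 * u ^+ 2 = - (a * 2) + (2 * u) *+ 2 by rewrite /a; ring.
    rewrite expRD ler_wpM2l ?expR_ge0// mulr2n expRD -expr2.
    rewrite ler_sqr ?nnegrE ?expR_ge0//; first exact: axis_bound.
    by rewrite addr_ge0 ?sqr_ge0// mulr_ge0 ?sqr_ge0 ?expR_ge0.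
have -> : 2 * t * u + (2 - t) * u ^+ 2 = a * t + 2 * u ^+ 2 by rewrite /a; ring.
have -> : (1 - u) ^+ 2 * ((1 + u - t * u) ^+ 2 + e / 2 * (t * u) ^+ 2)
    + expR t * e * u ^+ 4 = expR (a * t) * g t.
  by rewrite /g expRN mulVKf ?gt_eqF ?expR_gt0// /q; field.
by rewrite expRD ler_wpM2l ?expR_ge0.
Qed.

(** A convex quadratic lies below its chord over [0, m]; multiplied by [m], the gap is
    [A * p * m * (m - p)]. *)
Lemma quadratic_le (A B C M m p : R) : 0 <= A -> 0 <= p <= m ->
  C <= M -> A * m ^+ 2 + B * m + C <= M -> A * p ^+ 2 + B * p + C <= M.
Proof.
move=> A0 /andP[p0 pm] CM mM.
have [p_eq0|p_neq0] := eqVneq p 0; first by rewrite p_eq0 expr0n/= !mulr0 !add0r.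
have m0 : 0 < m by rewrite (lt_le_trans _ pm)// lt_def p_neq0.
rewrite -subr_ge0 -(pmulr_rge0 _ m0).
have -> : m * (M - (A * p ^+ 2 + B * p + C)) =
  p * (M - (A * m ^+ 2 + B * m + C)) + (m - p) * (M - C)
  + A * (p * (m * (m - p))) by ring.
by rewrite !addr_ge0// !mulr_ge0 ?subr_ge0// ltW.
Qed.

(* In terms of s = u1 + u2 and p = u1 * u2 the left-hand side is quadratic and
   convex along the level lines of the exponent t * s + (2 - t) * p, so it
   suffices to treat the two ends of each line in the quadrant, p = 0 and
   u1 = u2. *)
Lemma sensitivity_bound t u1 u2 : 0 < t <= 2 -> 0 <= u1 -> 0 <= u2 ->
  (1 - t / 2 * (u1 + u2) + (t - 1) * (u1 * u2)) ^+ 2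
    + expR 2 * ((t / 2 * (u1 * (1 - u2))) ^+ 2 + (t / 2 * (u2 * (1 - u1))) ^+ 2)
    + expR (t + 2) * (u1 * u2) ^+ 2
  <= expR (t * (u1 + u2) + (2 - t) * (u1 * u2)).
Proof.
move=> /andP[t0 t2] u10 u20; have tn0 := lt0r_neq0 t0.
set k := t * (u1 + u2) + _; pose p := u1 * u2.
have p0 : 0 <= p by rewrite mulr_ge0.
have p4 : 4 * p <= (u1 + u2) ^+ 2.
  rewrite -subr_ge0 (_ : _ - _ = (u1 - u2) ^+ 2) ?sqr_ge0// /p; ring.
have s0 : 0 <= u1 + u2 by rewrite addr_ge0.
have k0 : 0 <= k by rewrite addr_ge0// mulr_ge0//; lra.
(* The level line meets the diagonal at [u1 = u2 = z], the nonnegative root of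
   [2 * t * z + (2 - t) * z ^+ 2 = k], rationalised so that [t = 2] is covered. *)
pose r := Num.sqrt (t ^+ 2 + (2 - t) * k).
have r2 : r ^+ 2 = t ^+ 2 + (2 - t) * k.
  by rewrite sqr_sqrtr// addr_ge0 ?sqr_ge0// mulr_ge0//; lra.
have r0 : 0 <= r := sqrtr_ge0 _.
have rt0 : 0 < r + t by lra.
pose z := k / (r + t).
have z0 : 0 <= z by rewrite divr_ge0// ltW.
have zk : 2 * t * z + (2 - t) * z ^+ 2 = k.
  have E : (2 - t) * k = r ^+ 2 - t ^+ 2 by rewrite r2; ring.
  have -> : 2 * t * z + (2 - t) * z ^+ 2 = 2 * t * z + (2 - t) * k * (k / (r + t) ^+ 2).
    by rewrite /z; field; rewrite gt_eqF.
  by rewrite E /z; field; rewrite gt_eqF.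
(* If [p > z ^+ 2], then [4 * p <= (u1 + u2) ^+ 2] forces [u1 + u2 > 2 * z], and the exponent would
   exceed [k]. *)
have pz : p <= z ^+ 2.
  rewrite leNgt; apply/negP => zp.
  have sz : 2 * z < u1 + u2.
    have : (2 * z) ^+ 2 < (u1 + u2) ^+ 2 by rewrite exprMn; lra.
    by rewrite ltr_sqr// nnegrE mulr_ge0.
  have h1 : 0 < t * (u1 + u2 - 2 * z) by rewrite mulr_gt0// subr_gt0.
  have h2 : 0 <= (2 - t) * (p - z ^+ 2) by rewrite mulr_ge0// subr_ge0// ltW.
  by move: zk; rewrite /k -/p; lra.
set e := expR 2; set E := expR (t + 2).
have e0 : 0 <= e := expR_ge0 _.
have E0 : 0 <= E := expR_ge0 _.
(* Coefficients in [q] after eliminating [s] by [t * s = k - (2 - t) * q]. *)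
pose A := (t / 2) ^+ 2 + e / 4 * ((2 - t) ^+ 2 + 2 * t * (2 - t) + 2 * t ^+ 2) + E.
pose B := t * (1 - k / 2) + e / 4 * (- 2 * (2 - t) * k - 2 * t ^+ 2 - 2 * t * k).
pose C := (1 - k / 2) ^+ 2 + e / 4 * k ^+ 2.
have lhsE (s q : R) : t * s + (2 - t) * q = k ->
    (1 - t / 2 * s + (t - 1) * q) ^+ 2
    + e * (t / 2) ^+ 2 * (s ^+ 2 - 2 * q - 2 * q * s + 2 * q ^+ 2) + E * q ^+ 2
    = A * q ^+ 2 + B * q + C.
  move=> kE; by rewrite /A /B /C -kE; field.
have -> : (1 - t / 2 * (u1 + u2) + (t - 1) * (u1 * u2)) ^+ 2
    + e * ((t / 2 * (u1 * (1 - u2))) ^+ 2 + (t / 2 * (u2 * (1 - u1))) ^+ 2)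
    + E * (u1 * u2) ^+ 2 = A * p ^+ 2 + B * p + C.
  by rewrite -(lhsE (u1 + u2) p)// /p; field.
apply: (@quadratic_le A B C _ (z ^+ 2)).
- rewrite !addr_ge0 ?sqr_ge0// mulr_ge0 ?divr_ge0// !addr_ge0 ?mulr_ge0 ?sqr_ge0//; lra.
- by rewrite p0 pz.
- have -> : C = (1 - k / 2) ^+ 2 + e * (k / 2) ^+ 2 by rewrite /C; field.
  have {3}-> : k = 2 * (k / 2) by field.
  by apply: axis_bound; rewrite divr_ge0.
- rewrite -(lhsE (2 * z) (z ^+ 2)); last by rewrite -zk; ring.
  (* On the diagonal the first base factors as [(1 - z) * (1 + z - t * z)]. *)
  have <- : (1 - z) ^+ 2 * ((1 + z - t * z) ^+ 2 + e / 2 * (t * z) ^+ 2)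
      + E * z ^+ 4 = (1 - t / 2 * (2 * z) + (t - 1) * z ^+ 2) ^+ 2
      + e * (t / 2) ^+ 2 * ((2 * z) ^+ 2 - 2 * z ^+ 2 - 2 * z ^+ 2 * (2 * z)
        + 2 * (z ^+ 2) ^+ 2) + E * (z ^+ 2) ^+ 2 by field.
  by rewrite -zk; apply: diagonal_bound; rewrite // t2 ltW.
Qed.

End Analysis.

(** * Determinants of positive semidefinite matrices *)

Section Hadamard.
Context {F : realFieldType}.

Definition psdmx n (S : 'M[F]_n) : Prop :=
  S^T = S /\ forall x : 'rV[F]_n, 0 <= (x *m S *m x^T) 0 0.

Lemma psdmx_diag_ge0 n (S : 'M[F]_n) i : psdmx S -> 0 <= S i i.
Proof.
case=> _ /(_ (delta_mx 0 i)).
by rewrite -rowE trmx_delta -colE !mxE.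
Qed.

Lemma block_mx_form n (a : F) (v : 'rV[F]_n) (S : 'M[F]_n) (c : F) (x : 'rV[F]_n) :
  ((row_mx c%:M x) *m (block_mx a%:M v v^T S) *m (row_mx c%:M x)^T) 0 0 =
  a * c ^+ 2 + 2 * c * (v *m x^T) 0 0 + (x *m S *m x^T) 0 0.
Proof.
rewrite mul_row_block tr_row_mx mul_row_col !mulmxDl tr_scalar_mx.
have -> : x *m v^T *m c%:M = (c * (v *m x^T) 0 0)%:M.
  rewrite mul_mx_scalar -[x *m v^T]trmxK trmx_mul trmxK.
  by rewrite {1}[v *m x^T]mx11_scalar tr_scalar_mx scale_scalar_mx.
rewrite -!scalar_mxM !mul_scalar_mx -scalemxAl !mxE eqxx !mulr1n; ring.
Qed.

(* Induction on the size: if the corner entry a is zero then so is its row,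
   and otherwise the Schur complement of a is again positive semidefinite and
   has smaller diagonal entries. *)
Lemma hadamard_psd n (S : 'M[F]_n) : psdmx S -> \det S <= \prod_i S i i.
Proof.
elim: n => [|n IHn] in S *; first by rewrite det_mx00 big_ord0.
rewrite -[n.+1]/(1 + n)%N in S * => -[S_sym S_psd].
have [a [v [T [SE T_sym]]]] : exists a v (T : 'M[F]_n),
    S = block_mx a%:M v v^T T /\ T^T = T.
  exists (ulsubmx S 0 0), (ursubmx S), (drsubmx S).
  rewrite -mx11_scalar -{1}(submxK S).
  by rewrite -[dlsubmx S]trmxK trmx_dlsub S_sym trmx_drsub S_sym.
have form c (x : 'rV_n) : 0 <= a * c ^+ 2 + 2 * c * (v *m x^T) 0 0 + (x *m T *m x^T) 0 0.
  by have := S_psd (row_mx (c%:M : 'M[F]_1) x); rewrite SE block_mx_form.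
have S_diag : \prod_i S i i = a * \prod_i T i i.
  rewrite big_split_ord big_ord1/=; congr (_ * _).
    by rewrite SE block_mxEul mxE eqxx mulr1n.
  by apply: eq_bigr => i _; rewrite SE block_mxEdr.
have T_psd : psdmx T.
  split=> // x; have := form 0 x.
  by rewrite expr0n/= !mulr0 mul0r !add0r.
have a0 : 0 <= a.
  by have := form 1 0; rewrite trmx0 !mulmx0 !mxE mulr0 !addr0 expr1n mulr1.
rewrite S_diag; have [a_eq0|a_neq0] := eqVneq a 0.
  suff v0 : v = 0.
    by rewrite SE a_eq0 v0 trmx0 det_lblock det_scalar expr1 !mul0r.
  apply/rowP => j; rewrite mxE.
  apply/eqP; apply: contraT => vj_neq0.
  (* With [a = 0] the form is affine in [c]; this [c] gives it the value -1. *)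
  have := form (- (T j j + 1) / (2 * v 0 j)) (delta_mx 0 j).
  rewrite a_eq0 mul0r add0r trmx_delta -colE mxE -rowE -colE !mxE.
  by rewrite (_ : _ + _ = -1) ?ler0N1//; field.
have a_gt0 : 0 < a by rewrite lt_def a_neq0.
pose W := T - a^-1 *: (v^T *m v).
have W_diag i : W i i = T i i - a^-1 * v 0 i ^+ 2.
  by rewrite !mxE big_ord1 !mxE expr2.
have W_psd : psdmx W.
  split.
    by rewrite /W linearB/= linearZ/= trmx_mul trmxK T_sym.
  (* This [c] minimises the form, and the minimum is the form of [W] at [x]. *)
  move=> x; have := form (- (a^-1 * (v *m x^T) 0 0)) x.
  have -> : x *m W *m x^T =
      x *m T *m x^T - a^-1 *: ((v *m x^T)^T *m (v *m x^T)).
    by rewrite mulmxBr mulmxBl -scalemxAr -scalemxAl trmx_mul trmxK !mulmxA.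
  move: (v *m x^T) (x *m T *m x^T) => d Q.
  congr (0 <= _); rewrite !mxE big_ord1 mxE; field.
  exact: a_neq0.
have -> : \det S = a * \det W.
  have -> : S = block_mx 1%:M 0 (a^-1 *: v^T) 1%:M *m block_mx a%:M v 0 W.
    rewrite mulmx_block !mul0mx !mul1mx !addr0 SE; congr (block_mx _ _ _ _).
      by rewrite mul_mx_scalar scalerA mulfV// scale1r.
    by rewrite -scalemxAl addrC subrK.
  by rewrite det_mulmx det_lblock det_ublock !det1 det_scalar1 !mul1r.
rewrite ler_pM2l//; apply: (le_trans (IHn _ W_psd)).
apply: ler_prod => i _; rewrite psdmx_diag_ge0//= W_diag gerBl.
by rewrite mulr_ge0 ?sqr_ge0 ?invr_ge0.
Qed.

Lemma det_psd_le_trace n (S : 'M[F]_n.+1) :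
  psdmx S -> \det S <= (\tr S / n.+1%:R) ^+ n.+1.
Proof.
move=> S_psd; apply: (le_trans (hadamard_psd S_psd)).
have [] := @leif_AGM F 'I_n.+1 predT (fun i => S i i).
  by move=> i _; exact: psdmx_diag_ge0.
by rewrite card_ord.
Qed.

Lemma psdmx_gram_sum n m (c : 'I_m -> F) (g : 'I_m -> 'cV[F]_n) :
  (forall j, 0 <= c j) -> psdmx (\sum_j c j *: (g j *m (g j)^T)).
Proof.
move=> c0; split.
  rewrite linear_sum/=; apply: eq_bigr => j _.
  by rewrite linearZ/= trmx_mul trmxK.
move=> x; rewrite mulmx_sumr mulmx_suml summxE sumr_ge0// => j _.
rewrite -scalemxAr -scalemxAl mxE mulr_ge0//.
have -> : x *m (g j *m (g j)^T) *m x^T = (x *m g j) *m (x *m g j)^T.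
  by rewrite trmx_mul !mulmxA.
by move: (x *m g j) => d; rewrite !mxE big_ord1 mxE -expr2 sqr_ge0.
Qed.

End Hadamard.

(** * Information matrices and the parameter [t] *)

Section Design.
Context {R : realType}.

(** The information matrix is [G *m N *m G^T], where [\tr N] is a weighted mean of the quantities
    bounded by 1; hence [\det N <= (1 / 4) ^+ 4]. *)
Lemma det_info_matrix_le (beta : 'cV[R]_4) (X : set (R * R)) (G : 'M[R]_4)
    (h : R * R -> 'cV[R]_4) (m : nat) (y : 'I_m -> R * R) (v : 'I_m -> R) :
  is_design_on X y v ->
  (forall p, X p -> fvec p = G *m h p) ->
  (forall p, X p -> intensity beta p * \sum_i h p i 0 ^+ 2 <= 1) ->
  \det (info_matrix beta y v) <= \det ((1 / 4) *: (G *m G^T)).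
Proof.
case=> _ [Xy [v0 v1]] fG h1.
pose N := \sum_j (v j * intensity beta (y j)) *: (h (y j) *m (h (y j))^T).
have -> : info_matrix beta y v = G *m N *m G^T.
  rewrite /info_matrix mulmx_sumr mulmx_suml; apply: eq_bigr => j _.
  by rewrite fG// trmx_mul -scalemxAr -scalemxAl !mulmxA.
have N_psd : psdmx N.
  by apply: psdmx_gram_sum => j; rewrite mulr_ge0 ?expR_ge0.
have trN : \tr N <= 1.
  rewrite -v1 /N linear_sum/=; apply: ler_sum => j _.
  rewrite linearZ/= -mulrA ler_piMr// (le_trans _ (h1 _ (Xy j)))//.
  rewrite ler_wpM2l ?expR_ge0// ler_sum// => i _.
  by rewrite !mxE big_ord1 !mxE expr2.
have trN0 : 0 <= \tr N by apply: sumr_ge0 => i _; exact: psdmx_diag_ge0.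
have detN : \det N <= (1 / 4) ^+ 4.
  apply: (le_trans (det_psd_le_trace N_psd)).
  by rewrite lerXn2r ?nnegrE//; lra.
rewrite detZ !det_mulmx det_tr mulrAC mulrC -expr2 ler_wpM2r ?sqr_ge0//.
Qed.

Lemma intensity_betavec (b0 b1 b2 b12 : R) p :
  intensity (betavec b0 b1 b2 b12) p =
  expR (b0 + b1 * p.1 + b2 * p.2 + b12 * (p.1 * p.2)).
Proof.
rewrite /intensity !mxE !big_ord_recl big_ord0 !mxE/=.
by congr expR; ring.
Qed.

(** [t] is the positive root of [rho * t ^+ 2 + t - 2], which becomes linear at [rho = 0]. *)
Lemma diagonal_parameter (rho : R) : 0 <= rho ->
  let t := if 0 < rho then (Num.sqrt (1 + 8 * rho) - 1) / (2 * rho) else 2 in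
  0 < t <= 2 /\ rho * t ^+ 2 = 2 - t.
Proof.
move=> rho0 /=; case: ifPn => [rho_gt0|]; last first.
  by rewrite -leNgt => rho_le0; split; [apply/andP; split|have -> : rho = 0 by lra]; lra.
set r := Num.sqrt _.
have r0 : 0 <= r := sqrtr_ge0 _.
have r2 : r ^+ 2 = 1 + 8 * rho by rewrite sqr_sqrtr//; lra.
have r1 : 1 < r by rewrite -(@ltr_sqr _ 1) ?nnegrE// r2; lra.
set t := (r - 1) / _.
have t0 : 0 < t by rewrite divr_gt0//; lra.
have tE : rho * t ^+ 2 = 2 - t.
  have -> : rho * t ^+ 2 = (r ^+ 2 - 2 * r + 1) / (4 * rho).
    by rewrite /t; field; rewrite gt_eqF.
  by rewrite r2 /t; field; rewrite gt_eqF.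
split=> //; rewrite t0/=.
have : 0 <= rho * t ^+ 2 by rewrite mulr_ge0 ?sqr_ge0.
lra.
Qed.

End Design.

Theorem theorem3 (R : realType) (b0 b1 b2 b12 : R)
    (hb1 : b1 < 0) (hb2 : b2 < 0) (hb12 : b12 <= 0) :
  let rho := - b12 / (b1 * b2) in
  let t := if b12 < 0 then (Num.sqrt (1 + 8 * rho) - 1) / (2 * rho) else 2 in
  locally_D_optimal (betavec b0 b1 b2 b12) (@quadrant R)
    (fun i : 'I_4 => nth (0, 0)
       [:: (0, 0); (2 / `|b1|, 0); (0, 2 / `|b2|); (t / `|b1|, t / `|b2|)] i)
    (fun _ : 'I_4 => 1 / 4).
Proof.
move=> rho t.
have b1b2 : 0 < b1 * b2 by rewrite nmulr_lgt0.
have b12_rho : b12 = - (rho * (b1 * b2)).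
  by rewrite /rho divfK ?gt_eqF// opprK.
have rho0 : 0 <= rho by rewrite divr_ge0 ?oppr_ge0// ltW.
have [/andP[t0 t2] tE] : 0 < t <= 2 /\ rho * t ^+ 2 = 2 - t.
  have := diagonal_parameter rho0.
  by rewrite /= {1}/rho pmulr_lgt0 ?invr_gt0// oppr_gt0.
rewrite !ltr0_norm//; move: t0 t2 tE; move: t => t t0 t2 tE.
have tn0 : t != 0 by rewrite gt_eqF.
have b1n0 : b1 != 0 by rewrite lt_eqF.
have b2n0 : b2 != 0 by rewrite lt_eqF.
have b1V : 0 < (- b1)^-1 by rewrite invr_gt0 oppr_gt0.
have b2V : 0 < (- b2)^-1 by rewrite invr_gt0 oppr_gt0.
set x := (fun i : 'I_4 => _); set beta := betavec _ _ _ _.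
(* Linear predictors at the support points; the last is [b0 - 2 * t - rho * t ^+ 2], simplified by
   [tE]. *)
pose eta := [:: b0; b0 - 2; b0 - 2; b0 - t - 2].
have x_intensity i : intensity beta (x i) = expR (eta`_i / 2) ^+ 2.
  rewrite intensity_betavec -expRM_natl; congr expR.
  rewrite [RHS]mulrC divfK// b12_rho /eta /x.
  case: i => [[|[|[|[|//]]]] /= _]; try by field.
  have -> : b0 - t - 2 = b0 - 2 * t - rho * t ^+ 2 by rewrite tE; ring.
  by field; rewrite b1n0 b2n0.
pose G : 'M[R]_4 := \matrix_(k, i) (fvec (x i) k 0 * expR (eta`_i / 2)).
have infoE : info_matrix beta x (fun=> 1 / 4) = (1 / 4) *: (G *m G^T).
  apply/matrixP => k l; rewrite /info_matrix summxE !mxE mulr_sumr.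
  apply: eq_bigr => i _; rewrite x_intensity.
  by rewrite !mxE big_ord1 !mxE; ring.
(* The basis of the span of 1, x1, x2, x1 x2 dual to evaluation at the four
   support points. *)
pose g p : seq R := let u1 := - b1 * p.1 / t in let u2 := - b2 * p.2 / t in
  [:: 1 - t / 2 * (u1 + u2) + (t - 1) * (u1 * u2); t / 2 * (u1 * (1 - u2));
      t / 2 * (u2 * (1 - u1)); u1 * u2].
pose h p : 'cV[R]_4 := \col_i ((g p)`_i * expR (- (eta`_i / 2))).
split.
  split; last first.
    split; last by split=> [_|]; rewrite ?sumr_const ?card_ord; lra.
    by case=> [[|[|[|[|//]]]] ?]; split; rewrite //= mulr_ge0// ltW.
  have x1 : 2 / - b1 != 0 by rewrite mulf_neq0// gt_eqF.
  have x2 : 2 / - b2 != 0 by rewrite mulf_neq0// gt_eqF.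
  have x3 : t / - b1 != 0 by rewrite mulf_neq0// gt_eqF.
  have x4 : t / - b2 != 0 by rewrite mulf_neq0// gt_eqF.
  move=> i j /eqP xij; apply/val_inj; move: i j xij.
  case=> [[|[|[|[|//]]]] ?] [[|[|[|[|//]]]] ?] //;
    by rewrite xpair_eqE /= ?eqxx ?(eq_sym 0) ?(negPf x1) ?(negPf x2)
      ?(negPf x3) ?(negPf x4) ?andbF.
move=> m y v dyv; rewrite infoE; apply: (det_info_matrix_le (h := h) dyv).
  move=> p _; apply/colP => k; rewrite [RHS]mxE.
  have -> : \sum_i G k i * h p i 0 = \sum_i fvec (x i) k 0 * (g p)`_i.
    apply: eq_bigr => i _; rewrite [G k i]mxE [h p i 0]mxE expRN.
    by rewrite -mulrA [expR _ * _]mulrC divfK// gt_eqF ?expR_gt0.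
  rewrite !big_ord_recl big_ord0 !mxE /x /g /=.
  case: k => [[|[|[|[|//]]]] /= _]; by field; rewrite ?b1n0 ?b2n0 ?tn0.
move=> p [p1 p2]; rewrite intensity_betavec.
pose u1 := - b1 * p.1 / t; pose u2 := - b2 * p.2 / t.
have u10 : 0 <= u1 by apply: divr_ge0; [rewrite mulr_ge0// oppr_ge0|]; exact: ltW.
have u20 : 0 <= u2 by apply: divr_ge0; [rewrite mulr_ge0// oppr_ge0|]; exact: ltW.
have t02 : 0 < t <= 2 by rewrite t0 t2.
have := sensitivity_bound t02 u10 u20.
set S := (X in X <= _); set k := (X in _ <= expR X) => Sk.
(* The interaction term is [- rho * t ^+ 2 * u1 * u2], so [tE] makes the level lines of the
   intensity those of [k]. *)
have -> : b0 + b1 * p.1 + b2 * p.2 + b12 * (p.1 * p.2) = b0 - k.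
  rewrite b12_rho /k -tE /u1 /u2; field; exact: tn0.
have -> : \sum_i h p i 0 ^+ 2 = expR (- b0) * S.
  have sq (c s : R) : (c * expR (- (s / 2))) ^+ 2 = c ^+ 2 * expR (- s).
    by rewrite exprMn -expRM_natl mulrN [2 * _]mulrC divfK.
  rewrite !big_ord_recl big_ord0 !mxE /= !sq /S.
  have e2 : expR (- (b0 - 2)) = expR (- b0) * expR 2.
    by rewrite -expRD; congr expR; ring.
  have e3 : expR (- (b0 - t - 2)) = expR (- b0) * expR (t + 2).
    by rewrite -expRD; congr expR; ring.
  by rewrite e2 e3 -/u1 -/u2; ring.
rewrite mulrA -expRD (_ : b0 - k - b0 = - k); last by ring.
by rewrite expRN mulrC ler_pdivrMr ?expR_gt0// mul1r.
Qed.
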